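(* Assume $\mathrm{DHL}[k,2]$, where $k\ge 3$. Assume also that there are integers $1<m_1<m_2<\cdots<m_k$ and integers $\ell_{i,j}$ ($1\le i<j\le k$) such that \[ \frac{\ell_{i,j}\, m_i}{m_j-m_i}\in \mathcal{V}\quad\text{and}\quad \frac{\ell_{i,j}\, m_j}{m_j-m_i}\in \mathcal{V}\qquad (1\le i<j\le k). \] Then $\min\mathcal{D}\le 2\max_{i<j}\ell_{i,j}$. Moreover, if $\ell_{i,j}=\ell$ for all $1\le i<j\le k$, then $2\ell\in\mathcal{D}$.
   Context: $\phi$ denotes Euler's totient function and $\mathcal{V}=\{\phi(n):n\in\mathbb{N}\}$ is the set of totients. $\mathcal{D}$ denotes the set of positive integers $d$ for which the equation $\phi(a)-\phi(b)=d$ has infinitely many solution pairs $(a,b)$ of positive integers. A finite set of affine-linear forms $a_1x+b_1,\ldots,a_kx+b_k$ with positive integers $a_i$ and integers $b_i$ is called admissible if for every prime $p$ there is an integer $x$ with $p\nmid (a_1x+b_1)\cdots(a_kx+b_k)$. For positive integers $k,m$, the hypothesis $\mathrm{DHL}[k,m]$ is the statement: for any admissible $k$-tuple of linear forms $a_in+b_i$ ($1\le i\le k$), there are infinitely many positive integers $n$ for which at least $m$ of the numbers $a_in+b_i$ are simultaneously prime. *)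

(* Defs.v *)
From mathcomp Require Import all_boot all_order all_algebra.
From mathcomp Require Import boolp classical_sets cardinality.

Set Implicit Arguments.
Unset Strict Implicit.
Unset Printing Implicit Defensive.

Import Order.TTheory GRing.Theory Num.Theory.
Local Open Scope classical_set_scope.
Local Open Scope ring_scope.

(* [totient 0 = 0] is not a totient, whence the restriction to positive [n]. *)
Definition totients : set nat := [set totient n | n in [set n | (0 < n)%N]].

Definition is_totient_rat (q : rat) : Prop :=
  exists2 v : nat, totients v & q = v%:R.

Definition totient_differences : set int :=
  [set d : int | 0 < d /\
    infinite_set [set ab : nat * nat |
      [/\ (0 < ab.1)%N, (0 < ab.2)%N &
          (totient ab.1)%:Z - (totient ab.2)%:Z = d]]].

Definition prime_int (z : int) : bool := (0 <= z) && prime `|z|%N.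

(* The forms [a i * x + b i] constitute a set of [k] forms, so they are
   required to be pairwise distinct. *)
Definition admissible (k : nat) (a b : 'I_k -> int) : Prop :=
  [/\ forall i, 0 < a i,
      injective (fun i => (a i, b i)) &
      forall p : nat, prime p ->
        exists x : int, ~~ (p%:Z %| \prod_(i < k) (a i * x + b i))%Z].

Definition DHL (k m : nat) : Prop :=
  forall a b : 'I_k -> int, admissible a b ->
    infinite_set [set n : nat | (0 < n)%N /\
      (m <= #|[set i : 'I_k | prime_int (a i * n%:Z + b i)]%SET|)%N].

Definition is_min (E : set int) (x : int) : Prop := E x /\ lbound E x.
Definition is_max (E : set int) (x : int) : Prop := E x /\ ubound E x.

(* Main.v *)
(* If p = a n - 1 and q = b n - 1 are primes larger than u and v, where
   phi(u) = l b / (b - a) and phi(v) = l a / (b - a), then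
     phi(v q) - phi(u p) = l (a (b n - 2) - b (a n - 2)) / (b - a) = 2 l.
   The forms m_i n - 1 are admissible, since they take the value -1 at n = 0, so
   DHL[k,2] and the pigeonhole principle give a pair i < j for which m_i n - 1 and
   m_j n - 1 are simultaneously prime for infinitely many n. *)
Require Import Defs.
From mathcomp Require Import all_boot all_order all_algebra.
From mathcomp Require Import boolp classical_sets cardinality.
From mathcomp Require Import ring zify.

Import Order.TTheory GRing.Theory Num.Theory.
Local Open Scope classical_set_scope.
Local Open Scope ring_scope.

(** Clearing the denominator turns membership of a fraction in the set of totients into an integer
    identity, so that the rest can be done in [int]. *)
Lemma is_totient_ratP (x y : int) : 0 < y -> is_totient_rat (x%:~R / y%:~R) ->
  exists2 u : nat, (0 < u)%N & x = y * (totient u)%:Z.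
Proof.
move=> y_gt0 [_ [u u_gt0 <-] xyE]; exists u => //.
have y_neq0 : (y%:~R : rat) != 0 by rewrite intr_eq0 gt_eqF.
apply: (@intr_inj rat); rewrite intrM -[(totient u)%:Z%:~R]xyE.
by rewrite mulrC divfK.
Qed.

Lemma totient_mul_prime (u p : nat) : (0 < u < p)%N -> prime p ->
  totient (u * p) = (totient u * p.-1)%N.
Proof.
move=> /andP[u_gt0 ltup] p_pr; rewrite totient_coprime ?(totient_prime p_pr) //.
by rewrite coprime_sym prime_coprime // gtnNdvd.
Qed.

Lemma totient_difference_prime_forms (a b l : int) : 1 < a -> a < b ->
  is_totient_rat ((l * a)%:~R / (b - a)%:~R) ->
  is_totient_rat ((l * b)%:~R / (b - a)%:~R) ->
  infinite_set [set n : nat | prime_int (a * n%:Z - 1) && prime_int (b * n%:Z - 1)] ->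
  totient_differences (2 * l).
Proof.
move=> a_gt1 ltab.
have ba_gt0 : 0 < b - a by rewrite subr_gt0.
move=> /is_totient_ratP-/(_ ba_gt0)[v v_gt0 vE].
move=> /is_totient_ratP-/(_ ba_gt0)[u u_gt0 uE] infn.
have phiu_gt0 : (0 < totient u)%N by rewrite totient_gt0.
(* Positivity of [l] follows from [l * b = (b - a) * totient u], where all other factors are
   positive. *)
split; first by nia.
move=> fin; apply: infn.
(* [g] recovers [n] from the pair [(v * q, u * p)], since [q + 1 = b * n]. Finitely many solution
   pairs would thus leave only finitely many [n]. *)
pose g (xy : nat * nat) := ((xy.1 %/ v).+1 %/ `|b|)%N.
apply: (@sub_finite_set _ _ (`I_(u + v).+1 `|` g @` _));
  last by rewrite finite_setU; split; [exact: finite_II | exact: finite_image fin].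
move=> n /= /andP[/andP[p_ge0 p_pr] /andP[q_ge0 q_pr]].
(* Once [n > u + v], both [a * n - 1] and [b * n - 1] are at least [n], so [p > u] and [q > v],
   which gives the coprimality needed to split the totients. *)
have [n_small|n_big] := leqP n (u + v); [by left | right].
set p := `|(a * n%:Z - 1)%R|%N in p_pr.
set q := `|(b * n%:Z - 1)%R|%N in q_pr.
have pE : p%:Z = a * n%:Z - 1 by rewrite /p gez0_abs.
have qE : q%:Z = b * n%:Z - 1 by rewrite /q gez0_abs.
exists ((v * q)%N, (u * p)%N); last first.
  rewrite /g /= mulKn //.
  have -> : q.+1 = (n * `|b|)%N by nia.
  by rewrite mulnK //; lia.
have ltup : (u < p)%N by nia.
have ltvq : (v < q)%N by nia.
split; rewrite /= ?muln_gt0 ?u_gt0 ?v_gt0 ?prime_gt0 //.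
rewrite !totient_mul_prime ?u_gt0 ?v_gt0 // !PoszM.
have -> : (p.-1)%:Z = a * n%:Z - 2 by have := prime_gt0 p_pr; lia.
have -> : (q.-1)%:Z = b * n%:Z - 2 by have := prime_gt0 q_pr; lia.
apply: (mulfI (lt0r_neq0 ba_gt0)).
by rewrite mulrBr !mulrA -vE -uE; ring.
Qed.

(** Otherwise the [n] supplied by [DHL] would lie in a union, over the finitely many pairs, of
    finite sets. *)
Lemma DHL2_prime_forms_pair (k : nat) (a b : 'I_k -> int) :
  DHL k 2 -> admissible a b ->
  exists i j : 'I_k, (i < j)%N /\
    infinite_set [set n : nat | prime_int (a i * n%:Z + b i) &&
                                prime_int (a j * n%:Z + b j)].
Proof.
move=> dhl adm; apply: contrapT => no_pair; apply: (dhl a b adm).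
pose F (ij : 'I_k * 'I_k) := [set n : nat |
  prime_int (a ij.1 * n%:Z + b ij.1) && prime_int (a ij.2 * n%:Z + b ij.2)].
apply: (@sub_finite_set _ _
  (\bigcup_(ij in [set ij : 'I_k * 'I_k | (ij.1 < ij.2)%N]) F ij)); last first.
  apply: bigcup_finite => [|[i j] /= ltij]; first exact: finite_finset.
  by apply: contrapT => inf; apply: no_pair; exists i, j.
move=> n /= [_ /card_gt1P[i [j [+ + neq_ij]]]]; rewrite !inE => pi pj.
have [ltij|ltji|eqij] := ltngtP i j.
- by exists (i, j) => //; apply/andP.
- by exists (j, i) => //; apply/andP.
- by rewrite (ord_inj eqij) eqxx in neq_ij.
Qed.

Lemma admissible_sub1 (k : nat) (m : 'I_k -> int) :
  (forall i, 0 < m i) -> injective m -> admissible m (fun=> -1).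
Proof.
move=> m_gt0 m_inj; split=> // [i j [] /m_inj //|p p_pr].
(* At [0] the product is a power of [-1], which no prime divides; this one choice serves every
   [p]. *)
exists 0; rewrite (eq_bigr (fun=> -1)) => [|i _]; last by rewrite mulr0 add0r.
rewrite prodr_const dvdzE abszX absz_nat exp1n.
by rewrite dvdn1 neq_ltn prime_gt1 // orbT.
Qed.

Lemma ex_is_min (E : set int) : E !=set0 -> (forall x, E x -> 0 <= x) ->
  exists d, is_min E d.
Proof.
move=> [x Ex] E_ge0.
have exE : exists n : nat, `[< E n%:Z >].
  by exists `|x|%N; apply/asboolP; rewrite gez0_abs ?E_ge0.
case: (ex_minnP exE) => n /asboolP En n_min; exists n%:Z; split=> // y Ey.
by rewrite -(gez0_abs (E_ge0 _ Ey)) lez_nat n_min //; apply/asboolP;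
  rewrite gez0_abs ?E_ge0.
Qed.

Lemma ex_is_max_pairs (k : nat) (l : 'I_k -> 'I_k -> int) (i j : 'I_k) :
  (i < j)%N ->
  exists M, is_max [set x : int | exists i j : 'I_k, (i < j)%N /\ x = l i j] M.
Proof.
move=> ltij; pose P (ij : 'I_k * 'I_k) := (ij.1 < ij.2)%N.
have Pij : P (i, j) by [].
case: (arg_maxP (fun ij : 'I_k * 'I_k => l ij.1 ij.2) Pij) => -[i1 j1] P1 lmax.
exists (l i1 j1); split; first by exists i1, j1.
by move=> _ [i2 [j2 [lt2 ->]]]; apply: (lmax (i2, j2)).
Qed.

Theorem theorem4 (k : nat) (hk : (3 <= k)%N) (hDHL : DHL k 2)
    (m : 'I_k -> int) (l : 'I_k -> 'I_k -> int)
    (hm1 : forall i, 1 < m i)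
    (hm : forall i j : 'I_k, (i < j)%N -> m i < m j)
    (hl : forall i j : 'I_k, (i < j)%N ->
       is_totient_rat ((l i j * m i)%:~R / (m j - m i)%:~R) /\
       is_totient_rat ((l i j * m j)%:~R / (m j - m i)%:~R)) :
  (exists d M : int,
     [/\ is_min totient_differences d,
         is_max [set x : int | exists i j : 'I_k, (i < j)%N /\ x = l i j] M &
         d <= 2 * M]) /\
  (forall l0 : int, (forall i j : 'I_k, (i < j)%N -> l i j = l0) ->
     totient_differences (2 * l0)).
Proof.
have m_inj : injective m.
  move=> i j mij; apply: ord_inj.
  by have [/hm|/hm|//] := ltngtP i j; rewrite mij ltxx.
have adm : admissible m (fun=> -1).
  by apply: admissible_sub1 => // i; apply: lt_trans (hm1 i).
have [i [j [ltij inf]]] := DHL2_prime_forms_pair _ _ _ hDHL adm.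
have [hli hlj] := hl i j ltij.
have D2l : totient_differences (2 * l i j).
  exact: totient_difference_prime_forms _ _ _ (hm1 i) (hm i j ltij) hli hlj inf.
(* [DHL] does not reveal which pair [i], [j] occurs; a constant [l] makes this irrelevant, and in
   general the maximum [M] absorbs it. *)
split=> [|l0 l_const]; last by rewrite -(l_const i j ltij).
have [|x [/ltW]//|d [Dd d_min]] := @ex_is_min totient_differences.
  by exists (2 * l i j).
have [M [M_val M_max]] := ex_is_max_pairs _ l _ _ ltij.
exists d, M; split=> //.
apply: (le_trans (d_min _ D2l)); rewrite ler_pM2l //.
by apply: M_max; exists i, j.
Qed.
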